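(* For all integers $n\geq 0$, the degenerate Euler polynomials are expressed through the degenerate Bernoulli polynomials by $$\mathcal{E}_{n;q}(x)=\frac{c_{n;q}}{c_{n+1;q}}\sum_{k=0}^n\sum_{m=0}^{n-k}\binom{n+1}{k,m,n-k-m+1}_{c;q}\mathcal{E}_{m;q}\,\mathcal{B}_{k;q}(x),$$ and also by $$\mathcal{E}_{n;q}(x)=-2\,\frac{c_{n;q}}{c_{n+1;q}}\sum_{k=0}^n\binom{n+1}{k}_{c;q}\mathcal{E}_{n-k+1;q}\,\mathcal{B}_{k;q}(x).$$
   Context: Fix a complex parameter $q\neq 1$ such that $jq-(j-1)\neq 0$ for all integers $j\ge 1$. Let $Q_0(q)=1$, $Q_n(q)=\prod_{j=1}^{n}(jq-(j-1))$, and $c_{0;q}=1$, $c_{n;q}=n!/Q_{n-1}(q)$ for $n\ge 1$. The Carlitz-Tsallis deformed exponential is $e_q(x)=(1+(1-q)x)^{1/(1-q)}=\sum_{n\ge 0}x^n/c_{n;q}$ (as a formal power series). Put $\binom{n}{k}_{c;q}=\frac{c_{n;q}}{c_{k;q}c_{n-k;q}}$ for $0\le k\le n$, and $\binom{n+1}{k,m,n-k-m+1}_{c;q}=\frac{c_{n+1;q}}{c_{k;q}\,c_{m;q}\,c_{n-k+1-m;q}}$. The degenerate Bernoulli polynomials $\mathcal{B}_{n;q}(x)$ and degenerate Euler polynomials $\mathcal{E}_{n;q}(x)$ are defined by the formal power series identities in $t$ $$\frac{t}{e_q(t)-1}e_q(xt)=\sum_{n\ge0}\mathcal{B}_{n;q}(x)\frac{t^n}{c_{n;q}},\qquad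 \frac{2}{e_q(t)+1}e_q(xt)=\sum_{n\ge0}\mathcal{E}_{n;q}(x)\frac{t^n}{c_{n;q}},$$ and $\mathcal{E}_{n;q}=\mathcal{E}_{n;q}(0)$. *)

(* Defs.v *)
From HB Require Import structures.
From mathcomp Require Import all_boot all_order all_algebra.
From mathcomp Require Import boolp reals complex.

Set Implicit Arguments.
Unset Strict Implicit.
Unset Printing Implicit Defensive.

Import GRing.Theory Num.Theory.
Local Open Scope ring_scope.

(** * Formal power series in one indeterminate t *)

Record fps (A : Type) := Fps { fcoef : nat -> A }.

Section FpsRing.
Variable A : comNzRingType.
Implicit Types f g h : fps A.

HB.instance Definition _ := gen_eqMixin (fps A).
HB.instance Definition _ := gen_choiceMixin (fps A).

Lemma fpsP f g : (forall n, fcoef f n = fcoef g n) <-> f = g.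
Proof.
split=> [|-> //]; case: f g => f [g] /= fg; congr Fps; exact: functional_extensionality_dep.
Qed.

Definition fps_zero : fps A := Fps (fun=> 0).
Definition fps_opp f := Fps (fun n => - fcoef f n).
Definition fps_add f g := Fps (fun n => fcoef f n + fcoef g n).

Fact fps_addA : associative fps_add.
Proof. by move=> f g h; apply/fpsP => n /=; rewrite addrA. Qed.
Fact fps_addC : commutative fps_add.
Proof. by move=> f g; apply/fpsP => n /=; rewrite addrC. Qed.
Fact fps_add0 : left_id fps_zero fps_add.
Proof. by move=> f; apply/fpsP => n /=; rewrite add0r. Qed.
Fact fps_addN : left_inverse fps_zero fps_opp fps_add.
Proof. by move=> f; apply/fpsP => n /=; rewrite addNr. Qed.

HB.instance Definition _ :=
  GRing.isZmodule.Build (fps A) fps_addA fps_addC fps_add0 fps_addN.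

Definition fps_const (a : A) : fps A := Fps (fun n => if n == 0%N then a else 0).
Definition fps_mul f g :=
  Fps (fun n => \sum_(i < n.+1) fcoef f i * fcoef g (n - i)).

Definition fps_trunc N f : {poly A} := \poly_(i < N.+1) fcoef f i.

Lemma fps_mul_trunc N f g n : (n <= N)%N ->
  fcoef (fps_mul f g) n = (fps_trunc N f * fps_trunc N g)`_n.
Proof.
move=> nN; rewrite coefM; apply: eq_bigr => i _.
have iN : (i < N.+1)%N by rewrite ltnS (leq_trans _ nN) // -ltnS.
by rewrite !coef_poly iN ltnS (leq_trans (leq_subr _ _) nN).
Qed.

Lemma fps_truncM N f g n : (n <= N)%N ->
  (fps_trunc N (fps_mul f g))`_n = (fps_trunc N f * fps_trunc N g)`_n.
Proof. by move=> nN; rewrite coef_poly ltnS nN (fps_mul_trunc _ _ nN). Qed.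

Fact fps_mulA : associative fps_mul.
Proof.
move=> f g h; apply/fpsP => n; rewrite !(fps_mul_trunc _ _ (leqnn n)).
transitivity ((fps_trunc n f * (fps_trunc n g * fps_trunc n h))`_n).
  by rewrite !coefM; apply: eq_bigr => i _; rewrite fps_truncM ?leq_subr.
rewrite mulrA !coefM; apply: eq_bigr => i _.
by rewrite fps_truncM // -ltnS.
Qed.

Fact fps_mulC : commutative fps_mul.
Proof.
by move=> f g; apply/fpsP => n; rewrite !(fps_mul_trunc _ _ (leqnn n)) mulrC.
Qed.

Fact fps_mul1 : left_id (fps_const 1) fps_mul.
Proof.
move=> f; apply/fpsP => n /=; rewrite big_ord_recl /= subn0 mul1r big1 ?addr0 //.
by move=> i _; rewrite mul0r.
Qed.

Fact fps_mulDl : left_distributive fps_mul fps_add.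
Proof.
move=> f g h; apply/fpsP => n /=; rewrite -big_split.
by apply: eq_bigr => i _; rewrite mulrDl.
Qed.

Fact fps_one_neq0 : fps_const 1 != 0.
Proof.
by apply/eqP => /fpsP/(_ 0%N)/eqP; rewrite /= (negbTE (oner_neq0 A)).
Qed.

HB.instance Definition _ := GRing.Zmodule_isComNzRing.Build (fps A)
  fps_mulA fps_mulC fps_mul1 fps_mulDl fps_one_neq0.

Lemma fcoefM f g n :
  fcoef (f * g) n = \sum_(i < n.+1) fcoef f i * fcoef g (n - i).
Proof. by []. Qed.

Lemma fcoefD f g n : fcoef (f + g) n = fcoef f n + fcoef g n.
Proof. by []. Qed.

Lemma fcoefN f n : fcoef (- f) n = - fcoef f n.
Proof. by []. Qed.

Lemma fcoef1 n : fcoef (1 : fps A) n = (n == 0%N)%:R.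
Proof. by rewrite /=; case: eqP. Qed.

Lemma fcoef_sum (I : Type) (r : seq I) (P : pred I) (F : I -> fps A) n :
  fcoef (\sum_(i <- r | P i) F i) n = \sum_(i <- r | P i) fcoef (F i) n.
Proof. by elim/big_rec2: _ => //= i y _ _ ->. Qed.

Lemma fcoefX_lt h k n : fcoef h 0 = 0 -> (n < k)%N -> fcoef (h ^+ k) n = 0.
Proof.
move=> h0; elim: k n => // k IH n nk; rewrite exprS fcoefM big_ord_recl h0 mul0r.
rewrite add0r big1 // => i _; rewrite IH ?mulr0 //= /bump /=.
by have := ltn_ord i; case: n nk i => [|n] nk i //= lti; rewrite add1n subSS;
  apply: leq_ltn_trans (leq_subr _ _) _.
Qed.

(* The indeterminate t, and division by t of a series without constant term
   (the constant term is discarded). *)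
Definition fps_X : fps A := Fps (fun n => (n == 1%N)%:R).
Definition fps_divX f := Fps (fun n => fcoef f n.+1).

Lemma fps_divXK f : fcoef f 0 = 0 -> fps_X * fps_divX f = f.
Proof.
move=> f0; apply/fpsP => -[|n]; rewrite fcoefM big_ord_recl mul0r add0r.
  by rewrite big_ord0 f0.
rewrite big_ord_recl /= mul1r /bump /= subSS subn0 big1 ?addr0 // => i _.
by rewrite mul0r.
Qed.

End FpsRing.

(** ** Inversion: f is invertible iff its constant term is *)

Section FpsUnit.
Variable A : comUnitRingType.
Implicit Types f g h : fps A.

Definition fps_unit : pred (fps A) := fun f => fcoef f 0 \is a GRing.unit.

(* Geometric series: f = f_0 (1 - h) with h(0) = 0, so 1/f = f_0^-1 sum_k h^k;
   only the terms k <= n contribute to the coefficient of t^n. *)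
Definition fps_geom h := Fps (fun n => \sum_(k < n.+1) fcoef (h ^+ k) n).
Definition fps_inv f :=
  if fps_unit f then
    let a := fps_const (fcoef f 0)^-1 in a * fps_geom (1 - a * f)
  else f.

Lemma fps_constM (a b : A) : fps_const a * fps_const b = fps_const (a * b).
Proof.
apply/fpsP => n; rewrite fcoefM big_ord_recl /= subn0 big1 ?addr0 => [|i _].
  by case: (n == 0%N); rewrite ?mulr0.
by rewrite mul0r.
Qed.

Lemma fps_geomP h : fcoef h 0 = 0 -> fps_geom h * (1 - h) = 1.
Proof.
move=> h0; apply/fpsP => n.
have -> : fcoef (fps_geom h * (1 - h)) n
        = fcoef ((\sum_(k < n.+1) h ^+ k) * (1 - h)) n.
  rewrite !fcoefM; apply: eq_bigr => i _; congr (_ * _).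
  rewrite fcoef_sum /=; have le_in : (i.+1 <= n.+1)%N by [].
  rewrite (big_ord_widen _ (fun k => fcoef (h ^+ k) i) le_in) big_mkcond /=.
  apply: eq_bigr => k _; case: ifP => // /negbT; rewrite -leqNgt => lt_ik.
  by rewrite fcoefX_lt.
have -> : (\sum_(k < n.+1) h ^+ k) * (1 - h) = 1 - h ^+ n.+1.
  by rewrite -[1 - h ^+ _]opprB subrX1 mulrC -mulNr opprB.
by rewrite fcoefD fcoefN (fcoefX_lt h0) // subr0.
Qed.

Fact fps_mulVx : {in fps_unit, left_inverse 1 fps_inv *%R}.
Proof.
move=> f fU; rewrite /fps_inv [fps_unit f]fU; set a := fps_const _.
have h0 : fcoef (1 - a * f) 0 = 0.
  rewrite fcoefD fcoefN fcoef1 fcoefM big_ord1 /= mulVr ?subrr //.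
by have := fps_geomP h0; rewrite subKr mulrCA mulrA.
Qed.

Fact fps_unitPl f g : g * f = 1 -> fps_unit f.
Proof.
move/fpsP/(_ 0%N); rewrite fcoefM big_ord1 fcoef1 /= => gf.
by apply/unitrPr; exists (fcoef g 0); rewrite mulrC.
Qed.

Fact fps_inv_out : {in [predC fps_unit], fps_inv =1 id}.
Proof. by move=> f /negbTE fU; rewrite /fps_inv [fps_unit f]fU. Qed.

HB.instance Definition _ := GRing.ComNzRing_hasMulInverse.Build (fps A)
  fps_mulVx fps_unitPl fps_inv_out.

Lemma fps_unitE f : (f \is a GRing.unit) = (fcoef f 0 \is a GRing.unit).
Proof. by []. Qed.

End FpsUnit.

(** * Carlitz-Tsallis exponential, degenerate Bernoulli and Euler polynomials *)

Section Degenerate.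
Variable F : fieldType.
Implicit Types (q a : F) (n k m l : nat) (u w : {poly F}).

Definition ctQ q n : F := \prod_(1 <= j < n.+1) (j%:R * q - (j%:R - 1)).

Definition ctc q n : F :=
  if n is p.+1 then (p.+1)`!%:R / ctQ q p else 1.

Definition ct_binom q n k : F := ctc q n / (ctc q k * ctc q (n - k)).

Definition ct_trinom q n k m l : F := ctc q n / (ctc q k * ctc q m * ctc q l).

(* The series in t of (1 + w t)^a, by Newton's binomial formula. *)
Definition fps_pow1D a w : fps {poly F} :=
  Fps (fun n => ((\prod_(j < n) (a - j%:R)) / n`!%:R) *: w ^+ n).

(* The series in t of e_q(u t) = (1 + (1 - q) u t)^(1 / (1 - q)); the
   polynomial variable 'X plays the role of x, so that ct_exp q 1 is e_q(t)
   and ct_exp q 'X is e_q(x t). *)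
Definition ct_exp q u : fps {poly F} := fps_pow1D (1 - q)^-1 ((1 - q) *: u).

(* e_q(t) - 1 has no constant term, hence t / (e_q(t) - 1) is the inverse of
   (e_q(t) - 1) / t; see bern_quotP. *)
Definition bern_quot q : fps {poly F} := (fps_divX (ct_exp q 1 - 1))^-1.

Definition bern_gf q : fps {poly F} := bern_quot q * ct_exp q 'X.
Definition euler_gf q : fps {poly F} := 2%:R / (ct_exp q 1 + 1) * ct_exp q 'X.

Definition deg_bern q n : {poly F} := ctc q n *: fcoef (bern_gf q) n.
Definition deg_euler q n : {poly F} := ctc q n *: fcoef (euler_gf q) n.

Definition deg_euler0 q n : F := (deg_euler q n).[0].

(** ** The expansion of e_q and the generating function identities *)

Lemma fcoef_ct_exp q u n : q != 1 ->
  fcoef (ct_exp q u) n = (ctc q n)^-1 *: u ^+ n.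
Proof.
move=> q1; have q1' : 1 - q != 0 by rewrite subr_eq0 eq_sym.
rewrite /= exprZn scalerA; congr (_ *: _).
case: n => [|n]; first by rewrite big_ord0 fact0 expr0 divr1 mulr1 /= invr1.
rewrite /= invf_div mulrAC; congr (_ / _).
rewrite -[in X in _ ^+ X](card_ord n.+1) -prodr_const -big_split /=.
rewrite big_ord_recl /= subr0 mulVf // mul1r /ctQ big_add1 big_mkord.
apply: eq_bigr => i _; rewrite /bump /= add1n mulrBl mulVf //.
by rewrite mulrBr mulr1 !opprB addrCA.
Qed.

Lemma ctc_neq0 q n : [pchar F] =i pred0 ->
  (forall j, (1 <= j)%N -> j%:R * q - (j%:R - 1) != 0) -> ctc q n != 0.
Proof.
move=> F0 hq; case: n => [|n] /=; first exact: oner_neq0.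
apply: mulf_neq0; first by rewrite (proj1 (pcharf0P F) F0) -lt0n fact_gt0.
rewrite invr_eq0; rewrite /ctQ big_nat.
by elim/big_ind: _ => [|x y|j /andP[j1 _]];
  [exact: oner_neq0 | exact: mulf_neq0 | exact: hq].
Qed.

Lemma ct_exp1_coef0 q : q != 1 -> fcoef (ct_exp q 1) 0 = 1.
Proof. by move=> q1; rewrite fcoef_ct_exp // expr0 /= invr1 scale1r. Qed.

Lemma bern_quotP q : q != 1 -> bern_quot q * (ct_exp q 1 - 1) = fps_X {poly F}.
Proof.
move=> q1.
have e0 : fcoef (ct_exp q 1 - 1) 0 = 0.
  by rewrite fcoefD fcoefN ct_exp1_coef0 // fcoef1 subrr.
rewrite -{1}(fps_divXK e0) mulrCA mulVr ?mulr1 // fps_unitE /=.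
rewrite -[X in X + _]/(fcoef (ct_exp q 1) 1) fcoef_ct_exp // expr1n subr0.
by rewrite /= /ctQ big_geq // divr1 invr1 scale1r unitr1.
Qed.

Lemma bern_gfP q : [pchar F] =i pred0 ->
  (forall j, (1 <= j)%N -> j%:R * q - (j%:R - 1) != 0) ->
  bern_quot q * ct_exp q 'X = Fps (fun n => (ctc q n)^-1 *: deg_bern q n).
Proof.
move=> F0 hq; apply/fpsP => n; rewrite [RHS]/=.
by rewrite /deg_bern scalerA mulVf ?scale1r ?ctc_neq0.
Qed.

Lemma euler_gfP q : [pchar F] =i pred0 ->
  (forall j, (1 <= j)%N -> j%:R * q - (j%:R - 1) != 0) ->
  2%:R / (ct_exp q 1 + 1) * ct_exp q 'X
    = Fps (fun n => (ctc q n)^-1 *: deg_euler q n).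
Proof.
move=> F0 hq; apply/fpsP => n; rewrite [RHS]/=.
by rewrite /deg_euler scalerA mulVf ?scale1r ?ctc_neq0.
Qed.

Lemma euler_denom_unit q : [pchar F] =i pred0 -> q != 1 ->
  ct_exp q 1 + 1 \is a GRing.unit.
Proof.
move=> F0 q1; rewrite fps_unitE fcoefD ct_exp1_coef0 // fcoef1.
by rewrite -[1 + _]/(2%:R) -polyC_natr rmorph_unit // unitfE (proj1 (pcharf0P F) F0).
Qed.

End Degenerate.

(* Main.v *)
Require Import Defs.
From HB Require Import structures.
From mathcomp Require Import all_boot all_order all_algebra.
From mathcomp Require Import reals complex.
From mathcomp Require Import ring.

Import GRing.Theory Num.Theory.
Local Open Scope ring_scope.

(** Write e for the series [ct_exp q 1], E = 2 / (e + 1) for the Euler quotient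
    and B = t / (e - 1) for the Bernoulli quotient.  Since B * (e - 1) = t,

      t * (E * e_q(xt)) = (E * (e - 1)) * (B * e_q(xt)),

    and both formulas are the comparison of the coefficients of t^(n+1) in this
    identity ([fcoef_euler_gf], [deg_euler_bern]).  They differ only in the way
    the factor D = E * (e - 1) is expanded: as a Cauchy product, it gives the
    trinomial double sum ([fcoef_euler_diff]); and as E * (e + 1) = 2, it is also
    2 - 2 * E, whose coefficients of positive degree are those of -2 * E
    ([euler_diffE]).

    The formulas involve the numbers E_n = E_n(0), whereas the coefficients of E
    are polynomials in x.  That these are constant, hence equal to E_n / c_n, is
    shown without computing any inverse: replacing x by 0 is a ring morphism on
    series, it fixes e + 1 and 2, and so it fixes E ([euler_quot_const]). *)

Definition fps_map {A B : Type} (phi : A -> B) (f : fps A) : fps B :=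
  Fps (fun n => phi (fcoef f n)).

Lemma fps_mapM {A B : comNzRingType} (phi : {rmorphism A -> B}) (f g : fps A) :
  fps_map phi (f * g) = fps_map phi f * fps_map phi g.
Proof.
apply/fpsP => n; rewrite fcoefM /= rmorph_sum.
by apply: eq_bigr => i _; rewrite rmorphM.
Qed.

Lemma fps_mapD {A B : comNzRingType} (phi : {rmorphism A -> B}) (f g : fps A) :
  fps_map phi (f + g) = fps_map phi f + fps_map phi g.
Proof. by apply/fpsP => n; rewrite fcoefD /= rmorphD. Qed.

Lemma fps_map1 {A B : comNzRingType} (phi : {rmorphism A -> B}) :
  fps_map phi 1 = 1.
Proof. by apply/fpsP => -[|n]; rewrite fcoef1 /= ?rmorph1 ?rmorph0. Qed.

Lemma fcoefXM {A : comNzRingType} (f : fps A) n :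
  fcoef (fps_X A * f) n.+1 = fcoef f n.
Proof.
rewrite fcoefM big_ord_recl mul0r add0r big_ord_recl /= mul1r subn1.
by rewrite big1 ?addr0 // => i _; rewrite mul0r.
Qed.

Section EulerBernoulli.
Variables (F : fieldType) (q : F).
Hypotheses (F0 : [pchar F] =i pred0) (q1 : q != 1).
Hypothesis hq : forall j, (1 <= j)%N -> j%:R * q - (j%:R - 1) != 0.
Implicit Types n k l m : nat.

Definition euler_quot : fps {poly F} := 2%:R / (ct_exp q 1 + 1).

(** The factor D = t * E / B, by which multiplication turns the Bernoulli
    generating function into t times the Euler one. *)
Definition euler_diff : fps {poly F} := euler_quot * (ct_exp q 1 - 1).

Lemma euler_quotK : euler_quot * (ct_exp q 1 + 1) = 2%:R.
Proof. by rewrite divrK // euler_denom_unit. Qed.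

(** The value at x = 0 is embedded back as a constant polynomial, so that E can
    be compared with its own image. *)
Definition at_zero : {rmorphism {poly F} -> {poly F}} :=
  (polyC \o horner_eval 0)%FUN.

Lemma at_zeroE p : at_zero p = p.[0]%:P.
Proof. by []. Qed.

Lemma at_zero_exp1 : fps_map at_zero (ct_exp q 1) = ct_exp q 1.
Proof.
apply/fpsP => n; rewrite /fps_map; cbn [fcoef].
by rewrite !(fcoef_ct_exp _ _ q1) expr1n at_zeroE hornerZ hornerC -mul_polyC polyCM.
Qed.

Lemma at_zero_expX : fps_map at_zero (ct_exp q 'X) = 1.
Proof.
apply/fpsP => -[|n]; rewrite /fps_map fcoef1; cbn [fcoef];
  rewrite (fcoef_ct_exp _ _ q1) at_zeroE hornerZ hornerXn.
  by rewrite /= invr1 mul1r.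
by rewrite expr0n mulr0.
Qed.

(** The coefficients of E are constants: the image of E is again a quotient of 2
    by e + 1, and quotients by a unit are unique. *)
Lemma euler_quot_const : fps_map at_zero euler_quot = euler_quot.
Proof.
apply: (mulIr (euler_denom_unit F0 q1)); rewrite euler_quotK.
rewrite -[in LHS]at_zero_exp1 -[X in _ + X](fps_map1 at_zero) -fps_mapD.
by rewrite -fps_mapM euler_quotK (_ : 2%:R = 1 + 1) // fps_mapD fps_map1.
Qed.

Lemma fcoef_euler_quot n :
  fcoef euler_quot n = ((ctc q n)^-1 * deg_euler0 q n)%:P.
Proof.
rewrite /deg_euler0 /deg_euler hornerZ mulrA mulVf ?ctc_neq0 // mul1r.
rewrite -at_zeroE -[RHS]/(fcoef (fps_map at_zero (euler_quot * ct_exp q 'X)) n).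
by rewrite fps_mapM at_zero_expX mulr1 euler_quot_const.
Qed.

Lemma fcoef0_expB1 : fcoef (ct_exp q 1 - 1) 0 = 0.
Proof. by rewrite fcoefD fcoefN ct_exp1_coef0 // fcoef1 subrr. Qed.

(** The Cauchy product stops at m = l because e - 1 has no constant term. *)
Lemma fcoef_euler_diff l :
  fcoef euler_diff l.+1 =
    (\sum_(0 <= m < l.+1) deg_euler0 q m / (ctc q m * ctc q (l - m).+1))%:P.
Proof.
rewrite fcoefM big_ord_recr subnn fcoef0_expB1 mulr0 Monoid.mulm1 rmorph_sum.
rewrite big_mkord; apply: eq_bigr => i _.
have le_il : (i <= l)%N by rewrite -ltnS.
rewrite fcoef_euler_quot (subSn le_il) fcoefD fcoefN (fcoef_ct_exp _ _ q1).
rewrite expr1n fcoef1 subr0 alg_polyC -polyCM.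
by congr (_%:P); rewrite -mulrA mulrCA -invfM.
Qed.

Lemma euler_diffE : euler_diff = 2%:R - 2%:R * euler_quot.
Proof. by rewrite -[X in X - _]euler_quotK /euler_diff; ring. Qed.

Lemma fcoef_euler_diffN l :
  fcoef euler_diff l.+1 = (- 2%:R * (deg_euler0 q l.+1 / ctc q l.+1))%:P.
Proof.
rewrite euler_diffE (_ : 2%:R = 1 + 1) // mulrDl mul1r.
rewrite !(fcoefD, fcoefN) fcoef1 fcoef_euler_quot -!(polyCD, polyCN).
by congr (_%:P); ring.
Qed.

Lemma euler_gf_bern_gf : fps_X {poly F} * euler_gf q = bern_gf q * euler_diff.
Proof.
rewrite -(bern_quotP q1) /euler_gf -/euler_quot /bern_gf /euler_diff.
by ring.
Qed.

(** The term k = n + 1 of the Cauchy product drops out because D, like e - 1,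
    has no constant term. *)
Lemma fcoef_euler_gf n :
  fcoef (euler_gf q) n =
    \sum_(0 <= k < n.+1) fcoef (bern_gf q) k * fcoef euler_diff (n - k).+1.
Proof.
rewrite -fcoefXM euler_gf_bern_gf fcoefM big_ord_recr subnn.
have -> : fcoef euler_diff 0 = 0 by rewrite fcoefM big_ord1 fcoef0_expB1 mulr0.
rewrite mulr0 Monoid.mulm1 big_mkord.
apply: eq_bigr => i _; have le_in : (i <= n)%N by rewrite -ltnS.
by rewrite (subSn le_in).
Qed.

Lemma deg_euler_bern (d : nat -> F) n :
    (forall l, fcoef euler_diff l.+1 = (d l)%:P) ->
  deg_euler q n =
    ctc q n *: \sum_(0 <= k < n.+1) (d (n - k)%N / ctc q k) *: deg_bern q k.
Proof.
move=> dE; rewrite /deg_euler fcoef_euler_gf; congr (_ *: _).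
apply: eq_bigr => k _; rewrite dE mulrC mul_polyC /deg_bern scalerA.
by rewrite mulfVK ?ctc_neq0.
Qed.

Lemma deg_euler_bern_trinom n :
  deg_euler q n =
    (ctc q n / ctc q n.+1) *:
      \sum_(0 <= k < n.+1) \sum_(0 <= m < (n - k).+1)
        (ct_trinom q n.+1 k m (n - k - m).+1 * deg_euler0 q m) *: deg_bern q k.
Proof.
rewrite (deg_euler_bern _ _ fcoef_euler_diff) -scalerA; congr (_ *: _).
rewrite scaler_sumr; apply: eq_bigr => k _.
rewrite -scaler_suml scalerA; congr (_ *: _).
rewrite mulr_suml mulr_sumr; apply: eq_bigr => m _; rewrite /ct_trinom.
by field; rewrite !ctc_neq0.
Qed.

Lemma deg_euler_bern_binom n :
  deg_euler q n =
    (- 2%:R * (ctc q n / ctc q n.+1)) *: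
      \sum_(0 <= k < n.+1)
        (ct_binom q n.+1 k * deg_euler0 q (n - k).+1) *: deg_bern q k.
Proof.
rewrite (deg_euler_bern _ _ fcoef_euler_diffN) !scaler_sumr.
rewrite !big_mkord; apply: eq_bigr => k _; rewrite !scalerA; congr (_ *: _).
have le_kn : (k <= n)%N by rewrite -ltnS.
rewrite /ct_binom (subSn le_kn).
by field; rewrite !ctc_neq0.
Qed.

End EulerBernoulli.

Theorem theorem6p2 (R : realType) (q : R[i]) (hq1 : q != 1)
    (hq : forall j : nat, (1 <= j)%N -> j%:R * q - (j%:R - 1) != 0) (n : nat) :
  deg_euler q n =
    (ctc q n / ctc q n.+1) *:
      \sum_(0 <= k < n.+1) \sum_(0 <= m < (n - k).+1)
        (ct_trinom q n.+1 k m (n - k - m).+1 * deg_euler0 q m) *: deg_bern q k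
  /\
  deg_euler q n =
    (- 2%:R * (ctc q n / ctc q n.+1)) *:
      \sum_(0 <= k < n.+1)
        (ct_binom q n.+1 k * deg_euler0 q (n - k).+1) *: deg_bern q k.
Proof.
have F0 := @pchar_num R[i]; split.
  exact: deg_euler_bern_trinom.
exact: deg_euler_bern_binom.
Qed.
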